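(* Let $v=(v(n))_{n=1}^\infty$ and $w=(w(n))_{n=1}^\infty$ be bounded, strictly positive sequences such that $\left(\frac{v(n)}{w(n)}\right)_{n=n_0}^\infty$ is a decreasing sequence for some $n_0\in\mathbb{N}$. (i) If $\mathsf{C}$ maps $\ell_1(w)$ continuously into itself, then $\mathsf{C}$ also maps $\ell_1(v)$ continuously into itself. (ii) If $\mathsf{C}$ maps $\ell_1(w)$ compactly into itself, then $\mathsf{C}$ also maps $\ell_1(v)$ compactly into itself.
   Context: The discrete Cesàro operator $\mathsf{C}\colon\mathbb{C}^{\mathbb{N}}\to\mathbb{C}^{\mathbb{N}}$ is the linear map $\mathsf{C}x:=\left(\frac{x_1+\dots+x_n}{n}\right)_{n\in\mathbb{N}}$ for $x=(x_n)_{n\in\mathbb{N}}$, with $\mathbb{N}=\{1,2,\dots\}$. For a bounded, strictly positive sequence $w=(w(n))_{n=1}^\infty$, $\ell_1(w):=\{x\in\mathbb{C}^{\mathbb{N}}\colon \sum_{n=1}^\infty w(n)|x_n|<\infty\}$, a Banach space for the norm $\|x\|_{1,w}:=\sum_{n=1}^\infty w(n)|x_n|$. ''$\mathsf{C}$ maps $\ell_1(w)$ continuously (resp. compactly) into itself'' means that $\mathsf{C}(\ell_1(w))\subseteq\ell_1(w)$ and the restriction $\mathsf{C}\colon\ell_1(w)\to\ell_1(w)$ is a continuous (resp. compact) linear operator. A real sequence $(a_n)$ is decreasing if $a_{n+1}\le a_n$ for all indices $n$. *)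

(* Defs.v *)
From HB Require Import structures.
From mathcomp Require Import all_boot all_order all_algebra.
From mathcomp Require Import all_classical all_reals all_analysis.
From mathcomp Require Import complex.

Set Implicit Arguments.
Unset Strict Implicit.
Unset Printing Implicit Defensive.

Import Order.TTheory GRing.Theory Num.Theory.
Import numFieldNormedType.Exports.

Local Open Scope classical_set_scope.
Local Open Scope ring_scope.
Local Open Scope complex_scope.

(* Sequences indexed by {1, 2, ...} are encoded as functions on nat: the entry
   of index n + 1 is the value at n. *)

Record weight (R : realType) := Weight {
  weight_fun :> nat -> R;
  weight_gt0 : forall n, 0 < weight_fun n;
  weight_bounded : bounded_fun weight_fun }.

Section CesaroSequence.
Variable R : realType.

Definition cseq := nat -> (R[i])^o.

HB.instance Definition _ := GRing.Lmodule.on cseq.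

Definition cesaro (x : cseq) : cseq :=
  fun n => (\sum_(k < n.+1) x k) / n.+1%:R.

End CesaroSequence.

Section WeightedL1.
Variables (R : realType) (w : weight R).
Implicit Types x y : cseq R.

(* Normc.normc is the R-valued modulus on R[i]; the norm `|z| of the
   numFieldType R[i] is the same number seen in R[i]. *)
Definition wterm x : nat -> R := fun n => w n * Normc.normc (x n).

Definition l1_set : set (cseq R) := [set x | cvgn (series (wterm x))].

Definition l1_pred : {pred cseq R} := mem l1_set.

Lemma wterm_ge0 x n : 0 <= wterm x n.
Proof.
rewrite mulr_ge0 ?(ltW (weight_gt0 w n))//.
by case: (x n) => a b; exact: sqrtr_ge0.
Qed.

Lemma wtermD x y n : wterm (x + y) n <= wterm x n + wterm y n.
Proof.
by rewrite -mulrDr ler_wpM2l ?(ltW (weight_gt0 w n))//; exact: le_normcD.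
Qed.

Lemma wtermZ (a : R[i]) x : wterm (a *: x) = Normc.normc a *: wterm x.
Proof.
apply/funext => n.
by rewrite /wterm [LHS]/= Normc.normcM mulrCA.
Qed.

Lemma l1_submod_closed : submod_closed l1_pred.
Proof.
split.
  apply/mem_set; rewrite /l1_set /=.
  have -> : wterm 0 = fun=> 0.
    by apply/funext => n; rewrite /wterm [X in _ * X]Normc.normc0 mulr0.
  rewrite (_ : series _ = fun=> 0); first exact: is_cvg_cst.
  by apply/funext => n; rewrite /series /= big1.
move=> a x y /set_mem cx /set_mem cy; apply/mem_set.
apply: (@series_le_cvg _ _ (wterm (a *: x) + wterm y)) => [n|n|n|].
- exact: wterm_ge0.
- by rewrite addr_ge0 ?wterm_ge0.
- exact: wtermD.
- by apply: is_cvg_seriesD => //; rewrite wtermZ; exact: is_cvg_seriesZ.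
Qed.

HB.instance Definition _ :=
  GRing.isSubmodClosed.Build _ _ l1_pred l1_submod_closed.

Record l1 := L1 { l1_val :> cseq R; l1P : l1_val \in l1_pred }.

HB.instance Definition _ := [isSub for l1_val].
HB.instance Definition _ := [Choice of l1 by <:].
HB.instance Definition _ := [SubChoice_isSubLmodule of l1 by <:].

Definition l1_norm (x : l1) : R := limn (series (wterm x)).

Lemma l1_cvg (x : l1) : cvgn (series (wterm x)).
Proof. exact: set_mem (l1P x). Qed.

Lemma l1_normD (x y : l1) :
  (l1_norm (x + y))%:C <= (l1_norm x)%:C + (l1_norm y)%:C :> R[i].
Proof.
rewrite -rmorphD lecR /l1_norm -lim_seriesD; try exact: l1_cvg.
apply: lim_series_le; [exact: l1_cvg| |exact: wtermD].
by apply: is_cvg_seriesD; exact: l1_cvg.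
Qed.

Lemma l1_normZ (a : R[i]) (x : l1) :
  (l1_norm (a *: x))%:C = `|a| * (l1_norm x)%:C.
Proof.
rewrite /l1_norm [wterm _]wtermZ lim_seriesZ; last exact: l1_cvg.
by rewrite rmorphM; case: a.
Qed.

Lemma l1_norm0_eq0 (x : l1) : (l1_norm x)%:C = 0 :> R[i] -> x = 0.
Proof.
move=> [x0]; apply/val_inj/funext => n; apply: Normc.eq0_normc.
have s_le : series (wterm x) n.+1 <= 0.
  rewrite -x0; apply: nondecreasing_cvgn_le; last exact: l1_cvg.
  by apply: nondecreasing_series => k _ _; exact: wterm_ge0.
have : wterm x n <= 0.
  apply: le_trans s_le; rewrite /series /= big_nat_recr//=.
  by rewrite lerDr sumr_ge0// => k _; exact: wterm_ge0.
rewrite pmulr_rle0 ?weight_gt0// => le0.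
by apply/eqP; rewrite eq_le le0 /=; case: (l1_val x n) => a b; exact: sqrtr_ge0.
Qed.

HB.instance Definition _ := Lmodule_isNormed.Build R[i] l1
  l1_normD l1_normZ l1_norm0_eq0.

End WeightedL1.

Definition compact_operator (K : numFieldType) (V W : normedModType K)
    (T : {linear V -> W}) : Prop :=
  forall A : set V, bounded_set A -> precompact (T @` A).

(* Such a T exists iff cesaro maps l1 w into itself, and it is then the
   restriction of cesaro to l1 w. *)
Definition cesaro_restriction (R : realType) (w : weight R)
    (T : {linear l1 w -> l1 w}) : Prop :=
  forall x : l1 w, l1_val (T x) = cesaro (l1_val x).

Definition cesaro_continuous (R : realType) (w : weight R) : Prop :=
  exists T : {linear l1 w -> l1 w}, cesaro_restriction T /\ continuous T.

Definition cesaro_compact (R : realType) (w : weight R) : Prop :=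
  exists T : {linear l1 w -> l1 w}, cesaro_restriction T /\ compact_operator T.

(* Main.v *)
(* C is continuous on l1(w) iff there is c with
     sum_(n >= k) w n / (n + 1) <= c * w k  for all k,
   and compact iff for every c > 0 the same holds, for some m, with the sum
   restricted to n >= m.  Necessity is seen on the normalised unit vectors
   e_k / w k, sufficiency by exchanging the order of summation; compactness
   corresponds to uniformly small tails.
   Where v / w is nonincreasing, v n <= (v k / w k) * w n for n >= k, so such
   tail bounds pass from w to v; the finitely many indices k below n0 only
   change the constant. *)
From HB Require Import structures.
From mathcomp Require Import all_boot all_order all_algebra.
From mathcomp Require Import all_classical all_reals all_analysis.
From mathcomp Require Import complex lra.
Require Import Defs.

Set Implicit Arguments.
Unset Strict Implicit.
Unset Printing Implicit Defensive.

Import Order.TTheory GRing.Theory Num.Theory.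
Import numFieldNormedType.Exports.

Local Open Scope classical_set_scope.
Local Open Scope ring_scope.
Local Open Scope complex_scope.

(** * Tail bounds on a weight and their transfer from [w] to [v] *)

Section TailBounds.
Variable R : realType.
Implicit Types (v w : weight R) (m N k : nat) (c : R).

(** For [m = 0] the least such [c] is the norm of the Cesaro operator on [l1 w]; for general [m],
    that of the operator followed by deleting the entries below [m]. Finite [N] avoids convergence
    questions. *)
Definition tail_bound w m c := forall k N,
  \sum_(m <= n < N | (k <= n)%N) w n / n.+1%:R <= c * w k.

Lemma weight_div_ge0 w n d : 0 <= w n / d.+1%:R.
Proof. by rewrite divr_ge0 ?ltW ?weight_gt0. Qed.

Lemma tail_bound_ge0 w m c : tail_bound w m c -> 0 <= c.
Proof.
move=> /(_ 0%N 0%N); rewrite big_geq// => c0.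
by rewrite -(pmulr_lge0 _ (weight_gt0 w 0%N)).
Qed.

Lemma tail_bound_le w m m' c : (m <= m')%N -> tail_bound w m c ->
  tail_bound w m' c.
Proof.
move=> mm' wmc k N; have [Nm'|m'N] := leqP N m'.
  by rewrite big_geq// mulr_ge0 ?(tail_bound_ge0 wmc) ?ltW ?weight_gt0.
apply: le_trans (wmc k N); rewrite [leRHS](big_cat_nat mm' (ltnW m'N))/=.
by rewrite lerDr sumr_ge0// => n _; exact: weight_div_ge0.
Qed.

Lemma tail_bound0 w m c : tail_bound w m c -> exists c', tail_bound w 0 c'.
Proof.
move=> wmc; pose S := \sum_(0 <= n < m) w n / n.+1%:R.
have S0 : 0 <= S by apply: sumr_ge0 => n _; exact: weight_div_ge0.
have wI0 k : 0 <= S / w k by rewrite divr_ge0// ltW ?weight_gt0.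
(* The terms below [m] contribute at most [S], and only if [k < m]; the summand [j = k] times [w k]
   then pays for [S]. *)
exists ((\sum_(j < m) S / w j) + c) => k N.
wlog mN : N / (m <= N)%N => [hN|].
  apply: le_trans (hN (maxn m N) (leq_maxl m N)).
  rewrite [leRHS](big_cat_nat (leq0n N) (leq_maxr m N))/= lerDl sumr_ge0// => n _.
  exact: weight_div_ge0.
rewrite (big_cat_nat (leq0n m) mN)/= mulrDl lerD//.
have [km|mk] := ltnP k m.
  apply: (@le_trans _ _ S).
    by rewrite big_mkcond/= ler_sum// => n _; case: ifP => // _;
      exact: weight_div_ge0.
  by rewrite -ler_pdivrMr ?weight_gt0// (bigD1 (Ordinal km))//= lerDl sumr_ge0.
rewrite big_nat_cond big_pred0 ?mulr_ge0 ?sumr_ge0 ?ltW ?weight_gt0// => n.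
apply/negP => /andP[/andP[_ nm] kn].
by move: (leq_trans mk kn); rewrite leqNgt nm.
Qed.

Lemma tail_bound_quotient v w n0 :
  (forall n, (n0 <= n)%N -> v n.+1 / w n.+1 <= v n / w n) ->
  exists2 K : R, 0 < K & forall m c, (n0 <= m)%N -> tail_bound w m c ->
    tail_bound v m (c * K).
Proof.
move=> vw; have vw_le i j : (n0 <= i)%N -> (i <= j)%N -> v j / w j <= v i / w i.
  move=> n0i /subnK <-; elim: (j - i)%N => // d; apply: le_trans.
  by rewrite addSn vw// (leq_trans n0i)// leq_addl.
have r0 a b : 0 <= v a / v b by rewrite divr_ge0 ?ltW ?weight_gt0.
(* Chosen so that [v (maxn k n0)] is at most this constant times [v k]: the [1] serves [k >= n0],
   the summand [j = k] serves [k < n0]. *)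
exists (1 + \sum_(j < n0) v n0 / v j).
  by rewrite ltr_wpDr// sumr_ge0.
move=> m c n0m wmc k N.
have c0 := tail_bound_ge0 wmc.
(* The quotient is monotone only from [n0] on. Since [n >= m >= n0] in the sum, [k <= n] and
   [k' <= n] select the same terms. *)
pose k' := maxn k n0.
have vk' : v k' <= (1 + \sum_(j < n0) v n0 / v j) * v k.
  rewrite /k'; have [kn0|n0k] := ltnP k n0.
    rewrite -ler_pdivrMr ?weight_gt0// (bigD1 (Ordinal kn0))//= addrCA lerDl.
    by rewrite addr_ge0 ?sumr_ge0.
  by rewrite ler_peMl ?(ltW (weight_gt0 v k))// lerDl sumr_ge0.
rewrite -mulrA; apply: le_trans (ler_wpM2l c0 vk').
have -> : c * v k' = v k' / w k' * (c * w k').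
  by rewrite mulrACA mulVf ?mulr1 1?mulrC// gt_eqF ?weight_gt0.
have vw0 : 0 <= v k' / w k' by rewrite divr_ge0 ?ltW ?weight_gt0.
apply: le_trans (ler_wpM2l vw0 (wmc k' N)).
rewrite mulr_sumr big_nat_cond [leRHS]big_nat_cond.
rewrite [leRHS](eq_bigl (fun i => (m <= i < N)%N && (k <= i)%N)); last first.
  move=> i; rewrite /k' geq_max; case: (leqP m i) => //= mi.
  by rewrite (leq_trans n0m mi) andbT.
apply: ler_sum => n /andP[/andP[mn _] kn].
rewrite mulrA ler_wpM2r// -ler_pdivrMr ?weight_gt0// vw_le ?leq_maxr//.
by rewrite geq_max kn (leq_trans n0m mn).
Qed.

End TailBounds.

(** * Partial sums of weighted moduli, and images of unit vectors *)

Section PartialSums.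
Variables (R : realType) (w : weight R).
Implicit Types (x y : cseq R) (m N k : nat) (c : R).

Lemma normc_ge0 (z : R[i]) : 0 <= Normc.normc z.
Proof. by case: z => a b; exact: sqrtr_ge0. Qed.

Lemma normc_real (a : R) : Normc.normc a%:C = `|a|.
Proof. by rewrite /= expr0n addr0 sqrtr_sqr. Qed.

Lemma normc_nat n : Normc.normc (n%:R : R[i]) = n%:R.
Proof. by rewrite -(rmorph_nat (real_complex R)) normc_real ger0_norm. Qed.

Lemma le_normc_sum N (F : nat -> R[i]) :
  Normc.normc (\sum_(k < N) F k) <= \sum_(k < N) Normc.normc (F k).
Proof.
elim: N => [|N IH]; first by rewrite !big_ord0 Normc.normc0.
by rewrite !big_ord_recr/= (le_trans (le_normcD _ _))// lerD2r.
Qed.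

Lemma wtermB x y n : wterm w (x - y) n <= wterm w x n + wterm w y n.
Proof.
by apply: le_trans (wtermD w x (- y) n) _; rewrite lerD2l /wterm [X in _ * X]normcN.
Qed.

Lemma psum_le_l1_norm (x : l1 w) m N :
  \sum_(m <= n < N) wterm w x n <= l1_norm x.
Proof.
have nd : {homo series (wterm w x) : i j / (i <= j)%N >-> i <= j}.
  by apply: nondecreasing_series => i _ _; exact: wterm_ge0.
apply: le_trans (nondecreasing_cvgn_le nd (@l1_cvg _ _ x) (maxn m N)).
rewrite /series/= (big_cat_nat (leq0n m) (leq_maxl m N))/=.
apply: ler_wpDl; first by apply: sumr_ge0 => i _; exact: wterm_ge0.
have [mN|Nm] := leqP m N; first exact: lexx.
by rewrite big_geq ?sumr_ge0 1?ltnW// => i _; exact: wterm_ge0.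
Qed.

Lemma l1_psum_bounded x c : (forall N, \sum_(0 <= n < N) wterm w x n <= c) ->
  x \in l1_pred w.
Proof.
move=> xc; apply/mem_set/nondecreasing_is_cvgn.
  by apply: nondecreasing_series => i _ _; exact: wterm_ge0.
by exists c => _ [N _ <-]; exact: xc.
Qed.

Lemma l1_norm_le (x : l1 w) c :
  (forall N, \sum_(0 <= n < N) wterm w x n <= c) -> l1_norm x <= c.
Proof. by move=> xc; apply: limr_le; [exact: l1_cvg|exact: nearW]. Qed.

Lemma l1_tail_small (x : l1 w) (e : R) : 0 < e ->
  exists m, forall N, \sum_(m <= n < N) wterm w x n <= e.
Proof.
move=> e0; have /cvgrPdist_le/(_ _ e0)[m _ mx] := @l1_cvg _ _ x.
exists m => N; have [mN|Nm] := leqP m N; last by rewrite big_geq ?ltW// ltnW.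
(* The sum below [N] is at most the norm and the sum below [m] is within [e] of it, so the block
   between them is at most [e]. *)
have := psum_le_l1_norm x 0 N.
have := le_trans (ler_norm _) (mx m (leqnn m)); rewrite -/(l1_norm x).
rewrite /series/= (big_cat_nat (leq0n m) mN)/=.
lra.
Qed.

(* Exchange the order of summation in the terms |x k| w n / (n + 1) with
   k <= n and m <= n < N. *)
Lemma cesaro_psum_le m c x N : tail_bound w m c ->
  \sum_(m <= n < N) wterm w (cesaro x) n <= c * \sum_(0 <= k < N) wterm w x k.
Proof.
move=> wmc; apply: (@le_trans _ _ (\sum_(m <= n < N)
    \sum_(0 <= k < N | (k <= n)%N) w n / n.+1%:R * Normc.normc (x k))).
  rewrite big_nat_cond [leRHS]big_nat_cond.
  apply: ler_sum => n /andP[/andP[_ nN] _].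
  rewrite /wterm /cesaro -mulr_sumr Normc.normcM -mulrA ler_wpM2l//.
    by rewrite ltW ?weight_gt0.
  rewrite mulrC Normc.normcV.
  rewrite normc_nat ler_wpM2l ?invr_ge0//.
  apply: le_trans (le_normc_sum n.+1 x) _.
  by rewrite -(big_mkord xpredT (fun k => Normc.normc (x k))) [leLHS](big_nat_widen 0 n.+1 N).
rewrite (exchange_big_dep xpredT)//= mulr_sumr; apply: ler_sum => k _.
by rewrite -mulr_suml /wterm mulrA ler_wpM2r ?normc_ge0.
Qed.

Definition unit_seq k : cseq R := fun n => if n == k then (w k)^-1%:C else 0.

Lemma wterm_unit_seq k n : wterm w (unit_seq k) n = (n == k)%:R.
Proof.
rewrite /wterm /unit_seq; case: eqP => [->|_]; last by rewrite Normc.normc0 mulr0.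
by rewrite normc_real gtr0_norm ?invr_gt0 ?weight_gt0// divff// gt_eqF ?weight_gt0.
Qed.

Lemma unit_seq_psum_le k N : \sum_(0 <= n < N) wterm w (unit_seq k) n <= 1.
Proof.
under eq_bigr do rewrite wterm_unit_seq mulrb.
rewrite -big_mkcond/=; have [kN|Nk] := ltnP k N.
  by rewrite big_mkord (big_pred1 (Ordinal kN)).
rewrite big_nat_cond big_pred0// => n; apply/negP => /andP[/= nN /eqP nk].
by move: nN; rewrite nk ltnNge Nk.
Qed.

Definition unit_l1 k : l1 w := L1 (l1_psum_bounded (unit_seq_psum_le k)).

Lemma unit_l1_norm k : l1_norm (unit_l1 k) <= 1.
Proof. exact/l1_norm_le/unit_seq_psum_le. Qed.

Lemma wterm_cesaro_unit_seq k n :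
  wterm w (cesaro (unit_seq k)) n = if (k <= n)%N then w n / n.+1%:R / w k else 0.
Proof.
rewrite /wterm /cesaro /unit_seq -big_mkcond/=; case: leqP => [kn|nk].
  rewrite (big_pred1 (Ordinal (kn : (k < n.+1)%N)))//= Normc.normcM Normc.normcV normc_nat.
  by rewrite normc_real gtr0_norm ?invr_gt0 ?weight_gt0// mulrA mulrAC.
rewrite big_pred0 ?mul0r ?Normc.normc0 ?mulr0// => i; apply/negP => /eqP ik.
by have := ltn_ord i; rewrite ik ltnS leqNgt nk.
Qed.

(** The sums in [tail_bound] divided by [w k] are exactly the tail sums of the image of the [k]-th
    normalised unit vector. *)
Lemma tail_bound_unit m c :
  (forall k N, \sum_(m <= n < N) wterm w (cesaro (unit_seq k)) n <= c) ->
  tail_bound w m c.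
Proof.
move=> wmc k N; rewrite -ler_pdivrMr ?weight_gt0//; apply: le_trans (wmc k N).
rewrite mulr_suml big_mkcond/= ler_sum// => n _.
by rewrite wterm_cesaro_unit_seq.
Qed.

End PartialSums.

(** * The restricted operator: continuity, and necessity for compactness *)

Section CesaroOnL1.
Variable R : realType.
Implicit Types (w : weight R) (m N k : nat) (c : R).

Lemma l1_normE w (x : l1 w) : `|x| = (l1_norm x)%:C.
Proof. by []. Qed.

Lemma cesaro_linear : linear (@cesaro R).
Proof.
move=> a x y; apply/funext => n.
change ((\sum_(k < n.+1) (a * x k + y k)) / n.+1%:R =
  a * ((\sum_(k < n.+1) x k) / n.+1%:R) + (\sum_(k < n.+1) y k) / n.+1%:R).
by rewrite big_split/= mulrDl -mulr_sumr mulrA.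
Qed.

Section Restriction.
Variables (w : weight R) (c : R) (wc : tail_bound w 0 c).

Lemma cesaro_l1_subproof (x : l1 w) : cesaro x \in l1_pred w.
Proof.
apply: (@l1_psum_bounded _ _ _ (c * l1_norm x)) => N.
apply: le_trans (cesaro_psum_le x N wc) _.
by rewrite ler_wpM2l ?(tail_bound_ge0 wc)// psum_le_l1_norm.
Qed.

Definition cesaro_l1 (x : l1 w) : l1 w := L1 (cesaro_l1_subproof x).

Lemma cesaro_l1_linear : linear cesaro_l1.
Proof. by move=> a x y; apply/val_inj/cesaro_linear. Qed.

HB.instance Definition _ :=
  GRing.isLinear.Build R[i] (l1 w) (l1 w) *:%R cesaro_l1 cesaro_l1_linear.

Lemma tail_bound_restriction : exists T : {linear l1 w -> l1 w},
  cesaro_restriction T.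
Proof. by exists cesaro_l1. Qed.

End Restriction.

Section Operator.
Variables (w : weight R) (T : {linear l1 w -> l1 w}).
Hypothesis TC : cesaro_restriction T.

Lemma continuous_tail_bound : continuous T -> exists c, tail_bound w 0 c.
Proof.
move=> /linear_bounded_continuous/linear_boundedP/pinfty_ex_gt0[r r0 Tr].
(* The operator bound [r] lives in [R[i]]; being positive it is real, so it equals its real part. *)
exists (complex.Re r); apply: tail_bound_unit => k N.
have := Tr (unit_l1 w k); rewrite !l1_normE -(RRe_real (gtr0_real r0)).
rewrite -rmorphM lecR => Tk.
rewrite -(TC (unit_l1 w k)).
apply: le_trans (psum_le_l1_norm _ _ _) (le_trans Tk _).
rewrite ler_piMr ?unit_l1_norm//.
by move: r0; rewrite ltcE => /andP[_ /ltW].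
Qed.

Lemma tail_bound_continuous c : tail_bound w 0 c -> continuous T.
Proof.
move=> wc; apply/linear_bounded_continuous/linear_boundedP.
near=> r => x; apply: (@le_trans _ _ (c%:C * `|x|)).
  rewrite !l1_normE -rmorphM lecR; apply: l1_norm_le => N; rewrite TC.
  apply: le_trans (cesaro_psum_le x N wc) _.
  by rewrite ler_wpM2l ?(tail_bound_ge0 wc)// psum_le_l1_norm.
rewrite ler_wpM2r//; near: r; apply: nbhs_pinfty_ge.
by apply/complex_realP; exists c.
Unshelve. all: by end_near. Qed.

Lemma nbhs_l1_lt (x : l1 w) (e : R) : 0 < e ->
  \forall y \near x, l1_norm (x - y) < e.
Proof.
move=> e0; have eC : 0 < e%:C :> R[i] by rewrite ltcR.
near=> y; rewrite -ltcR -l1_normE; near: y.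
exact: cvgr_dist_lt.
Unshelve. all: by end_near. Qed.

(* Dini: the tails decrease to 0 pointwise and are 1-Lipschitz, hence are
   uniformly small on the compact closure of the image of the unit ball. *)
Lemma compact_tail_bound (e : R) : compact_operator T -> 0 < e ->
  exists m, tail_bound w m e.
Proof.
move=> Tc e0; pose A := [set x : l1 w | l1_norm x <= 1].
have bA : bounded_set A.
  exists 1; split=> // r r1 x Ax; apply: le_trans (ltW r1); rewrite l1_normE.
  by rewrite -[leRHS](rmorph1 (real_complex R)) lecR.
have := Tc _ bA; rewrite precompactE => /compact_near_coveringP.
move=> cov; pose P m (x : l1 w) := forall N, \sum_(m <= n < N) wterm w x n <= e.
have [m _ mT] : \forall m \near \oo, closure (T @` A) `<=` P m.
  apply: cov => x _; rewrite /P.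
  have e20 : 0 < e / 2 by rewrite divr_gt0.
  have [m0 xm0] := l1_tail_small x e20.
  (* Half of [e] goes to the tail of [x], half to the distance from [x] to [y]. *)
  exists ([set y | l1_norm (x - y) < e / 2], [set m | (m0 <= m)%N]).
    by split; [exact: nbhs_l1_lt|exists m0].
  move=> [y m] [/= xy m0m] N.
  rewrite [leRHS](splitr e).
  apply: (@le_trans _ _ (\sum_(m <= n < N) (wterm w x n + wterm w (x - y) n))).
    apply: ler_sum => n _; rewrite {1}(_ : l1_val y = l1_val x - l1_val (x - y)).
      exact: wtermB.
    by rewrite /= opprB addrCA subrr addr0.
  rewrite big_split/= lerD//; last first.
    exact: le_trans (psum_le_l1_norm (x - y) m N) (ltW xy).
  apply: le_trans (xm0 N); have [mN|Nm] := leqP m N.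
    by rewrite [leRHS](big_cat_nat m0m mN)/= lerDr sumr_ge0// => n _; exact: wterm_ge0.
  by rewrite big_geq ?sumr_ge0 1?ltnW// => n _; exact: wterm_ge0.
exists m; apply: tail_bound_unit => k N; rewrite -(TC (unit_l1 w k)).
apply: (mT m (leqnn m)); apply: subset_closure; exists (unit_l1 w k) => //.
exact: unit_l1_norm.
Qed.

End Operator.
End CesaroOnL1.

(** * Compactness of sets with uniformly small tails *)

Section UniformTails.
Variables (R : realType) (w : weight R).

(** The image filter clusters in the compact segment [[- M, M]], and an ultrafilter converges to its
    cluster points. *)
Lemma ultra_bounded_cvg (T : Type) (F : set_system T) (FU : UltraFilter F)
    (f : T -> R) (M : R) :
  (\forall x \near F, `|f x| <= M) -> exists l : R, f @ F --> l.
Proof.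
move=> fM; have FF : ProperFilter (f @ F) by exact: fmap_proper_filter.
have : (f @ F) [set` `[- M, M]].
  by apply: filterS fM => x; rewrite /= in_itv/= ler_norml.
move=> /(segment_compact FF)[l [_ cl]]; exists l => U lU.
have [//|FUc] := in_ultra_setVsetC (f @^-1` U) FU.
by have [t []] := cl (~` U) U FUc lU.
Qed.

Lemma normc_le_ReIm (z : R[i]) :
  Normc.normc z <= `|complex.Re z| + `|complex.Im z|.
Proof.
case: z => a b /=; rewrite -(@ger0_norm _ (`|a| + `|b|)) ?addr_ge0// -sqrtr_sqr.
rewrite ler_sqrt ?sqr_ge0// sqrrD !real_normK ?num_real//.
by rewrite lerD2r lerDl mulrn_wge0 ?mulr_ge0.
Qed.

Lemma normc_ge_ReIm (z : R[i]) :
  `|complex.Re z| <= Normc.normc z /\ `|complex.Im z| <= Normc.normc z.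
Proof.
case: z => a b /=; rewrite -!sqrtr_sqr !ler_sqrt ?addr_ge0 ?sqr_ge0//.
by rewrite lerDl lerDr !sqr_ge0.
Qed.

(** As [w n > 0], the bound confines the real and imaginary parts of the entry to a segment, so each
    converges along [F]. *)
Lemma ultra_coordinate_limit (F : set_system (l1 w)) (FU : UltraFilter F)
    (n : nat) (c : R) :
  (\forall x \near F, wterm w (l1_val x) n <= c) ->
  exists z : R[i], forall e, 0 < e ->
    \forall x \near F, w n * Normc.normc (l1_val x n - z) <= e.
Proof.
move=> Fc; have w0 := weight_gt0 w n.
have [a Ha] : exists a : R, (fun x : l1 w => complex.Re (l1_val x n)) @ F --> a.
  apply: (@ultra_bounded_cvg _ _ _ _ (c / w n)); apply: filterS Fc => x.
  rewrite /wterm mulrC -ler_pdivlMr//; apply: le_trans.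
  exact: (normc_ge_ReIm _).1.
have [b Hb] : exists b : R, (fun x : l1 w => complex.Im (l1_val x n)) @ F --> b.
  apply: (@ultra_bounded_cvg _ _ _ _ (c / w n)); apply: filterS Fc => x.
  rewrite /wterm mulrC -ler_pdivlMr//; apply: le_trans.
  exact: (normc_ge_ReIm _).2.
exists (a +i* b) => e e0; pose d := e / w n / 2.
have d0 : 0 < d by rewrite !divr_gt0.
move/cvgrPdist_le : Ha => /(_ _ d0); move/cvgrPdist_le : Hb => /(_ _ d0).
apply: filterS2 => x xb xa.
rewrite mulrC -ler_pdivlMr//; apply: le_trans (normc_le_ReIm _) _.
rewrite [leRHS](splitr (e / w n)); apply: lerD.
  by apply: le_trans xa; rewrite distrC; case: (l1_val x n).
by apply: le_trans xb; rewrite distrC; case: (l1_val x n).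
Qed.

Variable Q : nat -> R -> Prop.

(** [Q] collects the pairs of a starting index and a bound imposed on the tails from there. *)
Definition uniform_tails := [set x : l1 w | forall m d, Q m d ->
  forall N, \sum_(m <= n < N) wterm w x n <= d].

(* An ultrafilter on the set converges coordinatewise; the uniform tail bounds
   pass to the limit, so the convergence holds in norm. *)
Lemma compact_uniform_tails : (exists c, Q 0 c) ->
  (forall e, 0 < e -> exists m, Q m e) -> compact uniform_tails.
Proof.
move=> [c Qc] Qe; rewrite compact_ultra => F FU FQ.
have FF : ProperFilter F by exact: ultra_proper.
have term_le n : \forall x \near F, wterm w (l1_val x) n <= c.
  apply: filterS FQ => x /(_ _ _ Qc n.+1); rewrite big_nat_recr//=.
  by apply: le_trans; rewrite lerDr sumr_ge0// => i _; exact: wterm_ge0.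
have [y Hy] := choice (fun n => ultra_coordinate_limit FU (term_le n)).
have psum_cvg m N e : 0 < e ->
    \forall x \near F, \sum_(m <= n < N) wterm w (l1_val x - y) n <= e.
  elim: N e => [|N IH] e e0.
    by apply: nearW => x; rewrite big_geq ?ltW.
  have [mN|Nm] := leqP m N; last by apply: nearW => x; rewrite big_geq ?ltW.
  have e20 : 0 < e / 2 by rewrite divr_gt0.
  apply: filterS2 (IH _ e20) (Hy N _ e20) => x xN xy.
  by rewrite big_nat_recr//= [leRHS](splitr e) lerD.
(* Each bound involves finitely many coordinates at a time, so it survives the coordinatewise limit
   up to an arbitrary [e]. *)
have yQ m d : Q m d -> forall N, \sum_(m <= n < N) wterm w y n <= d.
  move=> Qd N; apply/ler_addgt0Pr => e e0.
  have [x [xQ xy]] := filter_ex (filterI FQ (psum_cvg m N _ e0)).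
  apply: le_trans (lerD (xQ _ _ Qd N) xy); rewrite -big_split/=.
  apply: ler_sum => n _.
  rewrite {1}(_ : y = l1_val x - (l1_val x - y)); first exact: wtermB.
  by rewrite opprB addrCA subrr addr0.
pose Y : l1 w := L1 (l1_psum_bounded (yQ _ _ Qc)).
exists Y; split; first exact: yQ.
apply/cvgrPdist_le => e e0.
have eR := RRe_real (gtr0_real e0); rewrite -eR.
have r0 : 0 < complex.Re e by rewrite -ltcR eR.
move: (complex.Re e) r0 => r r0.
(* Three quarters suffice: the head of [x - y], the tail of [x] and the tail of [y]. *)
have r40 : 0 < r / 4 by rewrite divr_gt0.
have [m Qm] := Qe _ r40.
apply: filterS2 FQ (psum_cvg 0%N m _ r40) => x xQ xy.
rewrite distrC l1_normE lecR; apply: l1_norm_le => N.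
rewrite -[l1_val (x - Y)]/(l1_val x - y).
have tail : \sum_(m <= n < N) wterm w (l1_val x - y) n <= r / 4 + r / 4.
  apply: le_trans (lerD (xQ _ _ Qm N) (yQ _ _ Qm N)); rewrite -big_split/=.
  by apply: ler_sum => n _; exact: wtermB.
have tail0 : 0 <= \sum_(m <= n < N) wterm w (l1_val x - y) n.
  by apply: sumr_ge0 => n _; exact: wterm_ge0.
have [mN|Nm] := leqP m N.
  rewrite (big_cat_nat (leq0n m) mN)/=.
  lra.
have tail1 : 0 <= \sum_(N <= n < m) wterm w (l1_val x - y) n.
  by apply: sumr_ge0 => n _; exact: wterm_ge0.
move: xy; rewrite (big_cat_nat (leq0n N) (ltnW Nm))/=.
lra.
Qed.

End UniformTails.

(** * Sufficiency for compactness, and passage from [w] to [v] *)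

Lemma tail_bound_compact (R : realType) (w : weight R)
    (T : {linear l1 w -> l1 w}) :
  cesaro_restriction T -> (forall e, 0 < e -> exists m, tail_bound w m e) ->
  compact_operator T.
Proof.
move=> TC wT A /pinfty_ex_gt0[M M0 AM].
(* On elements of norm at most [M], a tail constant [c] bounds the tails of the images by [c] times
   [M]. *)
pose Q m d := exists2 c, tail_bound w m c & d = c * complex.Re M.
have MR := RRe_real (gtr0_real M0).
have r0 : 0 < complex.Re M by rewrite -ltcR MR.
have : precompact (uniform_tails Q : set (l1 w)).
  apply: compact_precompact; first exact: norm_hausdorff.
  apply: compact_uniform_tails.
    have [m /tail_bound0[c wc]] := wT 1 ltr01.
    by exists (c * complex.Re M); exists c.
  move=> e e0; have [m wm] := wT (e / complex.Re M) (divr_gt0 e0 r0).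
  by exists m; exists (e / complex.Re M) => //; rewrite divfK// gt_eqF.
apply: precompact_subset => _ [x Ax <-] m _ [c wc ->] N; rewrite TC.
apply: le_trans (cesaro_psum_le x N wc) _.
rewrite ler_wpM2l ?(tail_bound_ge0 wc)//.
apply: le_trans (psum_le_l1_norm _ _ _) _.
by rewrite -lecR MR -l1_normE; exact: AM.
Qed.

Theorem proposition2p13 (R : realType) (v w : weight R)
    (hvw : exists n0 : nat, forall n : nat, (n0 <= n)%N ->
             v n.+1 / w n.+1 <= v n / w n) :
  (cesaro_continuous w -> cesaro_continuous v) /\
  (cesaro_compact w -> cesaro_compact v).
Proof.
case: hvw => n0 /tail_bound_quotient[K K0 wv]; split.
  move=> [T [TC /(continuous_tail_bound TC)[c wc]]].
  (* The transfer works only from [n0] on: start the sums there, transfer, then restore the first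
     terms at the cost of a larger constant. *)
  have /tail_bound0[c' vc'] := wv _ _ (leqnn n0) (tail_bound_le (leq0n n0) wc).
  have [S SC] := tail_bound_restriction vc'.
  by exists S; split=> //; exact: (tail_bound_continuous SC vc').
move=> [T [TC Tc]].
have vT e : 0 < e -> exists m, tail_bound v m e.
  (* The transfer multiplies the constant by [K], whence [e / K]. *)
  move=> e0; have eK0 : 0 < e / K by rewrite divr_gt0.
  have [m wm] := compact_tail_bound TC Tc eK0.
  exists (maxn n0 m); rewrite -[e](@divfK _ K) ?gt_eqF//.
  by apply: wv; [exact: leq_maxl|apply: tail_bound_le wm; exact: leq_maxr].
(* Any single tail bound, here with constant [1], already makes the operator act on [l1 v]. *)
have [m /tail_bound0[c vc]] := vT 1 ltr01.
have [S SC] := tail_bound_restriction vc.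
by exists S; split=> //; exact: tail_bound_compact SC vT.
Qed.
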